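(* There exists a universal constant $C>0$ such that the following holds. Let $k\ge1$ be an integer, let $p_1<\dots<p_k$ be prime numbers, and let $$F=\big\{p_1^{\varepsilon_1}\cdots p_k^{\varepsilon_k}\ :\ \varepsilon_j\in\{0,1\},\ 1\le j\le k\big\}.$$ Let $B$ be a positive integer, and let $N(B,F)$ be the number of quadruples $(n_1,n_2,n_3,n_4)$ of integers with $n_1n_2=n_3n_4$, $1\le n_1\le B$, $1\le n_3\le B$, $n_2,n_4\in F$. Then $$N(B,F)\le C\,B\,2^k\prod_{i=1}^k\Big(1+\frac1{4p_i}\Big)\min\Big(B,\Big(\frac54\Big)^k\Big)+C\,2^k\prod_{i=1}^k\Big(1+\frac1{3p_i}\Big)\min\Big(B\Big(\frac32\Big)^k,2^k\Big).$$ Also, $$N(B,F)\ge 2^kB+2^kB\sum_{\substack{n\in F\\ 1<n\le B}}\frac{2^{-\omega(n)}}{n}.$$ Further, if $F\subset[1,B]$, then $$N(B,F)\ge 2^kB\prod_{j=1}^k\Big(1+\frac1{2p_j}\Big).$$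
   Context: $\omega(n)$ denotes the number of distinct prime divisors of $n$, with $\omega(1)=0$. *)

(* Defs.v *)
From mathcomp Require Import all_boot all_order all_algebra finmap reals.
Set Implicit Arguments.
Unset Strict Implicit.
Unset Printing Implicit Defensive.

Import Order.TTheory GRing.Theory Num.Theory.
Local Open Scope nat_scope.
Local Open Scope fset_scope.

(* [primes 0 = primes 1 = [::]], so omega 1 = 0. *)
Definition omega (n : nat) : nat := size (primes n).

Definition subset_products (k : nat) (p : 'I_k -> nat) : {fset nat} :=
  [fset \prod_(i < k) p i ^ eps i | eps : {ffun 'I_k -> bool} in predT].

Definition interval1 (B : nat) : {fset nat} := [fset n in iota 1 B].

(* The quadruple (n1, n2, n3, n4) is the left-nested pair (((n1, n2), n3), n4);
   the integers involved are all positive, hence encoded in nat. *)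
Definition quadruples (B : nat) (F : {fset nat}) :
    {fset nat * nat * nat * nat} :=
  [fset q in interval1 B `*` F `*` interval1 B `*` F |
    let: (n1, n2, n3, n4) := q in n1 * n2 == n3 * n4].

Definition num_quadruples (B : nat) (F : {fset nat}) : nat :=
  #|` quadruples B F|.

(* Main.v *)
Require Import Defs.
From mathcomp Require Import all_boot all_order all_algebra finmap reals.
From mathcomp Require Import zify ring lra.
Set Implicit Arguments.
Unset Strict Implicit.
Unset Printing Implicit Defensive.

Import Order.TTheory GRing.Theory Num.Theory.
Local Open Scope nat_scope.

(* Identify F with the subsets of the primes, and write P d for the product of
   the primes in d. If n2 = P (f xor d) and n4 = P f, then after cancelling their
   gcd they become coprime a, b with a b = P d, and the number of (n1, n3) is at
   most B / max (a, b) <= B / sqrt (P d). Summing over f and d gives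
   N <= 2^k B prod (1 + 1 / sqrt p_i), and 1 + 1 / sqrt p <= 5/4 for p >= 16, so
   the finitely many smaller primes only cost a constant. Together with the
   trivial N <= 2^k B^2 this already bounds N by the first of the two terms.
   For the lower bounds, keep only the f disjoint from d and the f containing d:
   these are 2 * 2^(k - |d|) choices (if d is nonempty), each contributing at
   least floor (B / P d) >= B / (2 P d). *)

(** * Solutions of n1 x = n3 y with n1 and n3 in [1, B] *)

(* The ordinal [i : 'I_B] stands for the integer [i + 1] in [1, B]. *)
Definition num_solutions (B x y : nat) : nat :=
  #|[set n : 'I_B * 'I_B | n.1.+1 * x == n.2.+1 * y]|.

Lemma num_solutionsC B x y : num_solutions B x y = num_solutions B y x.
Proof.
pose sw (n : 'I_B * 'I_B) := (n.2, n.1).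
have swI : injective sw by move=> [a b] [c d] [-> ->].
rewrite /num_solutions -(card_imset _ swI); apply: eq_card => -[a b].
rewrite inE /= eq_sym; apply/imsetP/idP => [[[c d]]|H].
  by rewrite inE /= => H [-> ->].
by exists (b, a); rewrite ?inE.
Qed.

Lemma num_solutions_mull B g x y :
  0 < g -> num_solutions B (g * x) (g * y) = num_solutions B x y.
Proof.
move=> g0; apply: eq_card => -[a b]; rewrite !inE /= ![_.+1 * (g * _)]mulnCA.
by rewrite eqn_pmul2l.
Qed.

Lemma card_multiples B b : #|[set i : 'I_B | b %| i.+1]| = B %/ b.
Proof.
rewrite divn_count_dvd big_add1 /= big_mkord -sum1dep_card big_mkcond /=.
by apply: eq_bigr => i _; case: (_ %| _).
Qed.

(** Coprimality forces [b] to divide n1, and n1 determines n3 because [b] is positive. *)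
Lemma num_solutions_le B a b :
  0 < b -> coprime a b -> num_solutions B a b <= B %/ b.
Proof.
move=> b0 ab; rewrite -card_multiples /num_solutions.
have injfst : {in [set n : 'I_B * 'I_B | n.1.+1 * a == n.2.+1 * b] &,
    injective fst}.
  move=> [i j] [i' j']; rewrite !inE /= => /eqP E /eqP E' ii'; subst i'.
  congr pair; apply/val_inj; apply/eq_add_S/eqP.
  by rewrite -(eqn_pmul2r b0) -E -E'.
rewrite -(card_in_imset injfst); apply: subset_leq_card.
apply/subsetP => i /imsetP[[i' j]]; rewrite !inE /= => /eqP E ->.
by rewrite -(@Gauss_dvdl _ _ a) 1?coprime_sym // E dvdn_mull.
Qed.

Lemma num_solutions_ge B a : 0 < a -> B %/ a <= num_solutions B a 1.
Proof.
move=> a0; rewrite -card_multiples.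
(* The multiple n3 = j + 1 of [a] is paired with n1 = n3 / a; the predecessor is the index of n1 as
   an ordinal. *)
have ltB (j : 'I_B) : (j.+1 %/ a).-1 < B.
  by have := leq_div j.+1 a; have := ltn_ord j; lia.
pose h j : 'I_B * 'I_B := (Ordinal (ltB j), j).
have hI : injective h by move=> j j' /(congr1 snd).
rewrite -(card_imset _ hI); apply: subset_leq_card.
apply/subsetP => x /imsetP[j]; rewrite inE => aj ->.
by rewrite inE /= prednK ?divnK ?muln1 // divn_gt0 // dvdn_leq.
Qed.

(** * Squarefree products indexed by subsets of the primes *)

Section SquarefreeProducts.

Variables (k : nat) (p : 'I_k -> nat).
Hypotheses (p_prime : forall i, prime (p i)) (p_inj : injective p).

Notation subsets := {ffun 'I_k -> bool}.

(** The argument is any boolean function, so that intersections and differences of subsets can be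
    passed as plain lambdas. *)
Definition sqfree (e : 'I_k -> bool) : nat := \prod_(i < k) p i ^ e i.

Definition symdiff (f d : subsets) : subsets := [ffun i => f i (+) d i].

Lemma symdiffK f : involutive (symdiff f).
Proof. by move=> d; apply/ffunP => i; rewrite !ffunE addbA addbb. Qed.

Lemma sqfree_gt0 e : 0 < sqfree e.
Proof. by apply: prodn_gt0 => i; rewrite expn_gt0 prime_gt0. Qed.

Lemma dvd_sqfree q e :
  prime q -> (q %| sqfree e) = [exists i, (q == p i) && e i].
Proof.
move=> q_prime; rewrite /sqfree Euclid_dvd_prod // big_has_cond.
apply/hasP/existsP => -[i].
  move=> _; rewrite /= Euclid_dvdX //= => /andP[qp ei]; exists i.
  by rewrite -dvdn_prime2 // qp; case: (e i) ei.
move=> /andP[/eqP-> ei]; exists i; first by rewrite mem_index_enum.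
by rewrite /= ei expn1.
Qed.

Lemma prime_dvd_sqfree i e : (p i %| sqfree e) = e i.
Proof.
rewrite dvd_sqfree //; apply/existsP/idP => [[j /andP[/eqP/p_inj-> //]]|ei].
by exists i; rewrite eqxx.
Qed.

(** Unique factorisation: membership of [i] is read off from divisibility by [p i]. *)
Lemma sqfree_inj : injective (fun e : subsets => sqfree e).
Proof.
by move=> e e' E; apply/ffunP => i; rewrite -!prime_dvd_sqfree E.
Qed.

Lemma sqfree_eq1 (e : subsets) : (sqfree e == 1) = (e == [ffun=> false]).
Proof.
have -> : 1 = sqfree [ffun=> false].
  by rewrite /sqfree big1 // => i _; rewrite ffunE.
by rewrite (inj_eq sqfree_inj).
Qed.

Lemma omega_sqfree e : omega (sqfree e) = \sum_(i < k) e i.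
Proof.
have -> : \sum_(i < k) e i = size [seq p i | i <- enum e].
  rewrite size_map -cardE -sum1_card [RHS]big_mkcond.
  by apply: eq_bigr => i _; rewrite unfold_in; case: (e i).
rewrite /omega; apply/perm_size/uniq_perm;
  rewrite ?primes_uniq ?map_inj_uniq ?enum_uniq //.
move=> q; rewrite mem_primes sqfree_gt0 /=; apply/andP/mapP => [[q_prime]|[i]].
  rewrite dvd_sqfree // => /existsP[i /andP[/eqP-> ei]].
  by exists i; rewrite ?mem_enum.
by rewrite mem_enum => ei ->; rewrite p_prime prime_dvd_sqfree.
Qed.

Lemma sqfreeM e e' :
  (forall i, ~~ (e i && e' i)) ->
  sqfree e * sqfree e' = sqfree (fun i => e i || e' i).
Proof.
move=> disj; rewrite /sqfree -big_split; apply: eq_bigr => i _ /=.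
by rewrite -expnD; move: (disj i); case: (e i); case: (e' i).
Qed.

Lemma coprime_sqfree e e' :
  (forall i, ~~ (e i && e' i)) -> coprime (sqfree e) (sqfree e').
Proof.
move=> disj; rewrite coprime_has_primes ?sqfree_gt0 //.
apply/hasPn => q; rewrite /= !mem_primes !sqfree_gt0 /= => /andP[q_prime].
rewrite q_prime !dvd_sqfree // => /existsP[i /andP[/eqP-> ei]].
apply/negP => /existsP[j /andP[/eqP/p_inj <-]].
by move: (disj i); rewrite ei andbT => /negPf->.
Qed.

(** The bound B / sqrt (P d), squared to stay in the natural numbers. If a and b are the parts of P
    d outside and inside [f], the number c of solutions satisfies c a <= B and c b <= B;
    multiply. *)
Lemma num_solutions_sqfree_le B (f d : subsets) :
  num_solutions B (sqfree (symdiff f d)) (sqfree f) ^ 2 * sqfree d <= B ^ 2.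
Proof.
pose g := sqfree (fun i => f i && ~~ d i).
pose a := sqfree (fun i => d i && ~~ f i).
pose b := sqfree (fun i => d i && f i).
have -> : sqfree d = a * b.
  rewrite sqfreeM => [|i]; last by case: (d i); case: (f i).
  by apply: eq_bigr => i _; case: (d i); case: (f i).
have -> : sqfree f = g * b.
  rewrite sqfreeM => [|i]; last by case: (d i); case: (f i).
  by apply: eq_bigr => i _; case: (d i); case: (f i).
have -> : sqfree (symdiff f d) = g * a.
  rewrite sqfreeM => [|i]; last by case: (d i); case: (f i).
  by apply: eq_bigr => i _; rewrite ffunE; case: (d i); case: (f i).
rewrite num_solutions_mull ?sqfree_gt0 //.
have ab : coprime a b.
  by apply: coprime_sqfree => i; case: (d i); case: (f i).
have cb := num_solutions_le B (sqfree_gt0 _) ab.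
rewrite coprime_sym in ab.
have ca := num_solutions_le B (sqfree_gt0 _) ab.
rewrite num_solutionsC in ca; set c := num_solutions _ _ _ in ca cb *.
rewrite (_ : c ^ 2 * _ = (c * a) * (c * b)) -?mulnn; last by ring.
by apply: leq_mul; rewrite -leq_divRL ?sqfree_gt0.
Qed.

(** In both cases one of the two products is P d times the other, so cancelling leaves n1 P d = n3
    or its mirror image. *)
Lemma num_solutions_sqfree_ge B (f d : subsets) :
  [forall i, ~~ (d i && f i)] || [forall i, d i ==> f i] ->
  B %/ sqfree d <= num_solutions B (sqfree (symdiff f d)) (sqfree f).
Proof.
case/orP => /forallP H.
  have -> : sqfree (symdiff f d) = sqfree f * sqfree d.
    rewrite sqfreeM => [|i]; last by move: (H i); case: (f i); case: (d i).
    apply: eq_bigr => i _; rewrite ffunE.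
    by move: (H i); case: (f i); case: (d i).
  rewrite -{2}[sqfree f]muln1 num_solutions_mull ?sqfree_gt0 //.
  exact: num_solutions_ge (sqfree_gt0 _).
have -> : sqfree f = sqfree (symdiff f d) * sqfree d.
  rewrite sqfreeM => [|i]; last first.
    by rewrite ffunE; move: (H i); case: (f i); case: (d i).
  apply: eq_bigr => i _; rewrite ffunE.
  by move: (H i); case: (f i); case: (d i).
rewrite -{1}[sqfree (symdiff f d)]muln1 num_solutions_mull ?sqfree_gt0 //.
by rewrite num_solutionsC; exact: num_solutions_ge (sqfree_gt0 _).
Qed.

(** The counted set over a finite type, with subsets in place of their products, so that sums can be
    reindexed. *)
Definition quadruple_set (B : nat) : {set 'I_B * subsets * 'I_B * subsets} :=
  [set t : 'I_B * subsets * 'I_B * subsets |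
    t.1.1.1.+1 * sqfree t.1.1.2 == t.1.2.+1 * sqfree t.2].

Lemma num_quadruplesE B :
  num_quadruples B (subset_products p) = #|quadruple_set B|.
Proof.
pose h (t : 'I_B * subsets * 'I_B * subsets) :=
  (t.1.1.1.+1, sqfree t.1.1.2, t.1.2.+1, sqfree t.2).
have hI : injective h.
  move=> [[[i e] j] f] [[[i' e'] j'] f'] [].
  by move=> /val_inj-> /sqfree_inj-> /val_inj-> /sqfree_inj->.
(* Both cardinals are lengths of duplicate-free lists, and [h] carries one list onto the other up to
   order. *)
rewrite /num_quadruples cardE -(size_map h); apply: perm_size.
apply: uniq_perm; rewrite ?fset_uniq ?map_inj_uniq ?enum_uniq //.
move=> [[[x a] y] b]; apply/idP/mapP.
  rewrite !inE /= !mem_iota -!andbA !add1n.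
  case/and5P => x0 xB /imfsetP[/= e _ ->] y0 /andP[yB].
  case/andP => /imfsetP[/= f _ ->] E.
  case: x x0 xB E => // x _ xB; case: y y0 yB => // y _ yB E.
  rewrite ltnS in xB; rewrite ltnS in yB.
  by exists (Ordinal xB, e, Ordinal yB, f); rewrite // mem_enum inE.
case=> -[[[i e] j] f]; rewrite mem_enum inE /= => E [-> -> -> ->].
rewrite !inE /= !mem_iota !add1n !ltnS !ltn_ord E /= andbT.
by rewrite andbT; apply/andP; split; apply/imfsetP; [exists e|exists f].
Qed.

Lemma num_quadruples_sum B :
  num_quadruples B (subset_products p) =
    \sum_(d : subsets) \sum_(f : subsets)
      num_solutions B (sqfree (symdiff f d)) (sqfree f).
Proof.
rewrite num_quadruplesE exchange_big /=.
under eq_bigr => f _.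
  (* For fixed [f], substituting d = f xor e turns the subset of n2 into the free variable [e]. *)
  rewrite (reindex_inj (inv_inj (symdiffK f))) /=.
  under eq_bigr => e _.
    rewrite symdiffK /num_solutions -sum1dep_card big_mkcond; over.
  rewrite pair_bigA; over.
rewrite pair_bigA -sum1dep_card big_mkcond /=.
rewrite (reindex (fun u : subsets * (subsets * ('I_B * 'I_B)) =>
  (u.2.2.1, u.2.1, u.2.2.2, u.1))) //=.
by exists (fun t => (t.2, (t.1.1.2, (t.1.1.1, t.1.2))))
  => [[f [e [i j]]]|[[[i e] j] f]] _.
Qed.

(** A quadruple is determined by n1, n3 and n4, since n1 is positive. *)
Lemma num_quadruples_le_sqr B :
  num_quadruples B (subset_products p) <= B ^ 2 * 2 ^ k.
Proof.
have -> : B ^ 2 * 2 ^ k = #|{: 'I_B * 'I_B * subsets}|.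
  by rewrite !card_prod card_ffun card_bool !card_ord mulnn.
rewrite num_quadruplesE.
apply: (@leq_card_in _ _ (fun t => (t.1.1.1, t.1.2, t.2))).
move=> [[[i e] j] f] [[[i' e'] j'] f']; rewrite !inE /= => /eqP E /eqP E'.
move=> [ii jj ff]; move: E'; rewrite -{}ii -{}jj -{}ff -{}E => /eqP.
by rewrite eqn_pmul2l // => /eqP/sqfree_inj->.
Qed.

End SquarefreeProducts.

(** * Upper and lower bounds over the reals *)

Local Open Scope ring_scope.

Section RealBounds.

Variables (R : realType) (k : nat) (p : 'I_k -> nat).
Hypotheses (p_prime : forall i, prime (p i)) (p_inj : injective p).

Notation subsets := {ffun 'I_k -> bool}.
Notation P := (sqfree p).

Let P_gt0 e : (0 : R) < (P e)%:R.
Proof. by rewrite ltr0n sqfree_gt0. Qed.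

Lemma sum_subsets_prod (w : 'I_k -> bool -> R) :
  \sum_(d : subsets) \prod_(i < k) w i (d i) =
  \prod_(i < k) (w i true + w i false).
Proof.
by rewrite -bigA_distr_bigA; apply: eq_bigr => i _; rewrite big_bool.
Qed.

Lemma natr_sqfree e : (P e)%:R = \prod_(i < k) (p i)%:R ^+ e i :> R.
Proof. by rewrite natr_prod; apply: eq_bigr => i _; rewrite natrX. Qed.

Lemma inv_sqrt_sqfree e :
  (Num.sqrt (P e)%:R)^-1 =
  \prod_(i < k) (if e i then (Num.sqrt (p i)%:R)^-1 else 1) :> R.
Proof.
rewrite natr_sqfree; set x := \prod_(i < k) _ ^+ _; set y := \prod_(i < k) _.
suff: 0 <= x /\ (Num.sqrt x)^-1 = y by case.
rewrite /x /y; elim/big_rec2: _ => [|i a b _ [b_ge0 <-]].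
  by rewrite sqrtr1 invr1.
rewrite mulr_ge0 ?exprn_ge0 // sqrtrM ?exprn_ge0 // invfM.
by case: (e i); rewrite ?expr1 // expr0 sqrtr1 invr1.
Qed.

Lemma num_quadruples_le_prod B :
  (num_quadruples B (subset_products p))%:R <=
  2 ^+ k * B%:R * \prod_(i < k) (1 + (Num.sqrt (p i)%:R)^-1) :> R.
Proof.
rewrite num_quadruples_sum // natr_sum.
have le_sqrt (d f : subsets) :
    (num_solutions B (P (symdiff f d)) (P f))%:R
      <= B%:R * (Num.sqrt (P d)%:R)^-1 :> R.
  rewrite ler_pdivlMr ?sqrtr_gt0 ?P_gt0 //.
  (* Squaring both sides leads back to the integer inequality of [num_solutions_sqfree_le]. *)
  rewrite -(@ler_pXn2r _ 2) ?nnegrE ?mulr_ge0 ?sqrtr_ge0 ?ler0n //.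
  rewrite exprMn sqr_sqrtr ?ler0n // -!natrX -natrM ler_nat.
  exact: num_solutions_sqfree_le.
have -> : \prod_(i < k) (1 + (Num.sqrt (p i)%:R)^-1) =
    \sum_(d : subsets) (Num.sqrt (P d)%:R)^-1 :> R.
  under [RHS]eq_bigr => d _ do rewrite inv_sqrt_sqfree.
  rewrite (sum_subsets_prod (fun i b => if b then (Num.sqrt (p i)%:R)^-1 else 1)).
  by apply: eq_bigr => i _; rewrite addrC.
rewrite mulr_sumr; apply: ler_sum => d _.
rewrite natr_sum; apply: le_trans (ler_sum _ (fun f _ => le_sqrt d f)) _.
by rewrite sumr_const card_ffun card_bool card_ord -[leLHS]mulr_natl natrX mulrA.
Qed.

(** At most 16 of the distinct primes are below 16, and each has a factor of at most 2; the others
    have 1 / sqrt p <= 1/4. *)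
Lemma prod_sqrt_le :
  \prod_(i < k) (1 + (Num.sqrt (p i)%:R)^-1) <= 2 ^+ 16 * (5 / 4) ^+ k :> R.
Proof.
have small : (#|[set i | (p i < 16)%N]| <= 16)%N.
  rewrite -[X in (_ <= X)%N](card_ord 16).
  apply: (@leq_card_in _ _ (fun i => inord (p i))) => i j.
  rewrite !inE => pi pj /(congr1 val); rewrite /= !inordK //; exact: p_inj.
apply: (@le_trans _ _
    (\prod_(i < k) ((if (p i < 16)%N then 2 else 1) * (5 / 4)))).
  apply: ler_prod => i _; rewrite addr_ge0 ?invr_ge0 ?sqrtr_ge0 ?ler01 //=.
  have [small_p|large_p] := ltnP.
    apply: (@le_trans _ _ 2); last by lra.
    rewrite (_ : 2 = 1 + 1) // lerD2l invf_le1 ?sqrtr_gt0 ?ltr0n ?prime_gt0 //.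
    by rewrite -{1}sqrtr1 ler_sqrt ?ler1n ?ltr0n ?prime_gt0.
  rewrite mul1r (_ : 5 / 4 = 1 + 4^-1); last by field.
  rewrite lerD2l lef_pV2 ?posrE ?sqrtr_gt0 ?ltr0n // ?prime_gt0 //.
  rewrite (_ : 4 = Num.sqrt (16%:R)).
    by rewrite ler_sqrt ?ler_nat ?ltr0n ?prime_gt0.
  by rewrite (_ : 16%:R = 4 ^+ 2) ?sqrtr_sqr ?ger0_norm //; ring.
rewrite big_split prodr_const card_ord ler_pM2r; last by apply: exprn_gt0; lra.
rewrite -big_mkcond /= prodr_const ler_weXn2l ?ler1n //.
by rewrite -cardsE.
Qed.

Lemma num_quadruples_upper B :
  (num_quadruples B (subset_products p))%:R <=
    2 ^+ 16 * B%:R * 2 ^+ k * Num.min B%:R ((5 / 4) ^+ k) :> R.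
Proof.
have c0 : 0 <= 2 ^+ k * B%:R :> R by rewrite mulr_ge0 ?exprn_ge0.
rewrite minr_pMr; last by rewrite !mulr_ge0 ?exprn_ge0.
rewrite le_min; apply/andP; split.
  (* The first branch of the minimum is the trivial bound, the second the product bound. *)
  apply: (@le_trans _ _ (B%:R * 2 ^+ k * B%:R)).
    by rewrite mulrAC -expr2 -!natrX -natrM ler_nat num_quadruples_le_sqr.
  rewrite ler_wpM2r // ler_wpM2r ?exprn_ge0 // ler_peMl //.
  by rewrite -natrX ler1n.
apply: le_trans (num_quadruples_le_prod B) _.
apply: (le_trans (ler_wpM2l c0 prod_sqrt_le)).
by rewrite le_eqVlt; apply/orP; left; apply/eqP; ring.
Qed.

(** The indicator of a coordinatewise condition is a product over coordinates, so distributivity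
    counts such subsets. *)
Lemma sum_forall (Q : 'I_k -> bool -> bool) :
  \sum_(f : subsets) [forall i, Q i (f i)]%:R =
  \prod_(i < k) ((Q i true)%:R + (Q i false)%:R) :> R.
Proof.
rewrite -(sum_subsets_prod (fun i b => (Q i b)%:R)); apply: eq_bigr => f _.
case: forallP => [Qf|/forallP]; first by rewrite big1 // => i _; rewrite Qf.
rewrite negb_forall => /existsP[i /negPf Qi].
by rewrite (bigD1 i) //= Qi mul0r.
Qed.

(** The factor is 1 for [i] in [d] and 2 outside: the choices left for a subset whose trace on [d]
    is prescribed. *)
Lemma prod_half_pow (d : subsets) :
  2 ^+ k * 2 ^- (\sum_(i < k) d i) = \prod_(i < k) (2 * 2 ^- d i) :> R.
Proof. by rewrite big_split prodr_const card_ord expr_sum prodfV. Qed.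

(** The exponent is the number of primes dividing P d, so this is the sum of 2^(-omega n) / n over
    all n in F. *)
Lemma prod_half_inv :
  \prod_(i < k) (1 + 1 / (2 * (p i)%:R)) =
  \sum_(d : subsets) 2 ^- (\sum_(i < k) d i) / (P d)%:R :> R.
Proof.
under [RHS]eq_bigr => d _.
  rewrite natr_sqfree expr_sum -!prodfV -big_split.
  rewrite (eq_bigr (fun i => if d i then 1 / (2 * (p i)%:R) else 1)); last first.
    move=> i _ /=; case: (d i); last by rewrite !expr0 !invr1 mulr1.
    by rewrite !expr1 -invfM div1r.
  over.
rewrite (sum_subsets_prod (fun i b => if b then 1 / (2 * (p i)%:R) else 1)).
by apply: eq_bigr => i _; rewrite addrC.
Qed.

(** Common source of both lower bounds, proved separately for each [d]. *)
Lemma num_quadruples_lower B :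
  2 ^+ k * B%:R * (\sum_(d : subsets | (P d <= B)%N)
     2 ^- (\sum_(i < k) d i) / (P d)%:R) <=
  (num_quadruples B (subset_products p))%:R :> R.
Proof.
rewrite num_quadruples_sum // natr_sum mulr_sumr big_mkcond.
apply: ler_sum => d _; case: ifP => [PdB|_]; last exact: ler0n.
(* The quotient q is at least 1, so B < (q + 1) P d <= 2 q P d. *)
have floor_ge : B%:R / (P d)%:R <= 2 * (B %/ P d)%:R :> R.
  rewrite ler_pdivrMr // -!natrM ler_nat.
  have := ltn_ceil B (sqfree_gt0 p_prime d).
  have : (0 < B %/ P d)%N by rewrite divn_gt0 ?sqfree_gt0.
  move: (B %/ P d)%N => q; nia.
(* For empty [d] every [f] qualifies and the quotient is exactly [B], so the floor loses nothing. *)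
have [->|d_neq0] := eqVneq d [ffun=> false].
  set z := [ffun=> false].
  have Pz : P z = 1%N by apply/eqP; rewrite sqfree_eq1.
  rewrite Pz big1 => [|i _]; last by rewrite ffunE.
  rewrite expr0 !invr1 !mulr1 -natrX -natrM ler_nat.
  apply: (@leq_trans (\sum_(f : subsets) B)).
    by rewrite sum_nat_const card_ffun card_bool card_ord.
  apply: leq_sum => f _.
  have := @num_solutions_sqfree_ge _ _ p_prime B f z.
  rewrite Pz divn1; apply; apply/orP; left.
  by apply/forallP => i; rewrite ffunE.
(* For nonempty [d] the two families are disjoint and equally large; together they make up for the
   factor 2 lost to the floor. *)
pose A f := [forall i, ~~ (d i && f i)].
pose A' f := [forall i, d i ==> f i].
have sumA :
    \sum_(f : subsets) (A f)%:R = 2 ^+ k * 2 ^- (\sum_(i < k) d i) :> R.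
  rewrite (sum_forall (fun i b => ~~ (d i && b))) prod_half_pow.
  by apply: eq_bigr => i _; case: (d i) => /=; field.
have sumA' :
    \sum_(f : subsets) (A' f)%:R = 2 ^+ k * 2 ^- (\sum_(i < k) d i) :> R.
  rewrite (sum_forall (fun i b => d i ==> b)) prod_half_pow.
  by apply: eq_bigr => i _; case: (d i) => /=; field.
rewrite mulrACA.
apply: (@le_trans _ _ (2 ^+ k * 2 ^- (\sum_(i < k) d i) * (2 * (B %/ P d)%:R))).
  by rewrite ler_wpM2l // mulr_ge0 ?invr_ge0 ?exprn_ge0.
rewrite mulrA [_ * 2]mulr_natr mulr2n -{1}sumA -sumA' -big_split /= mulr_suml.
rewrite natr_sum; apply: ler_sum => f _.
rewrite -natrD -natrM ler_nat.
have AA' : ~~ (A f && A' f).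
  apply: contra d_neq0 => /andP[/forallP Af /forallP A'f].
  apply/eqP/ffunP => i; rewrite ffunE.
  by move: (Af i) (A'f i); case: (d i) => //=; case: (f i).
have : A f || A' f -> (B %/ P d <= num_solutions B (P (symdiff f d)) (P f))%N.
  exact: num_solutions_sqfree_ge.
by move: AA'; case: (A f); case: (A' f) => //= _; rewrite ?mul1n ?addn0 => ->.
Qed.

End RealBounds.

(** * Deduction of the three estimates *)

Theorem theorem1p4 (R : realType) :
  exists C : R, 0 < C /\
    forall (k : nat) (p : 'I_k -> nat) (B : nat),
      (1 <= k)%N ->
      (forall i : 'I_k, prime (p i)) ->
      (forall i j : 'I_k, (i < j)%N -> (p i < p j)%N) ->
      (0 < B)%N ->
      let F := subset_products p in
      let N : R := (num_quadruples B F)%:R in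
      [/\ N <= C * B%:R * 2 ^+ k * (\prod_(i < k) (1 + 1 / (4 * (p i)%:R)))
               * Num.min (B%:R) ((5 / 4) ^+ k)
             + C * 2 ^+ k * (\prod_(i < k) (1 + 1 / (3 * (p i)%:R)))
               * Num.min (B%:R * (3 / 2) ^+ k) (2 ^+ k),
          2 ^+ k * B%:R
            + 2 ^+ k * B%:R
              * (\sum_(n <- F | (1 < n <= B)%N) 2 ^- omega n / n%:R) <= N
        & (F `<=` interval1 B)%fset ->
          2 ^+ k * B%:R * (\prod_(i < k) (1 + 1 / (2 * (p i)%:R))) <= N].
Proof.
(* The constant comes from [prod_sqrt_le]. *)
exists (2 ^+ 16); split; first exact: exprn_gt0.
move=> k p B _ p_prime p_mono B_gt0 F N.
have p_inj : injective p.
  move=> i j pij; apply/val_inj.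
  by case: (ltngtP i j) => // /p_mono; rewrite pij ltnn.
(* This allows the Euler products to be inserted in the upper bound. *)
have prod_ge1 (c : R) : 0 < c -> 1 <= \prod_(i < k) (1 + 1 / (c * (p i)%:R)).
  move=> c0; elim/big_ind: _ => // [x y x1 y1|i _]; first exact: mulr_ege1.
  by rewrite lerDl divr_ge0 // mulr_ge0 // ltW.
have lower := num_quadruples_lower R p_prime p_inj B.
split.
- apply: (le_trans (num_quadruples_upper R p_prime p_inj B)).
  (* [N] is bounded by the first summand, and the second is nonnegative. *)
  rewrite -[leLHS]addr0 lerD //.
    rewrite ler_wpM2r ?le_min ?ler0n ?exprn_ge0 ?divr_ge0 //.
    by rewrite ler_peMr ?prod_ge1 // !mulr_ge0 ?exprn_ge0.
  rewrite mulr_ge0 //; last by rewrite le_min ?mulr_ge0 ?exprn_ge0 ?divr_ge0.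
  by rewrite !mulr_ge0 ?exprn_ge0 // (le_trans ler01) ?prod_ge1.
- apply: le_trans lower; rewrite -[X in X + _]mulr1 -mulrDr.
  rewrite ler_wpM2l ?mulr_ge0 ?exprn_ge0 //.
  rewrite /F /subset_products big_mkcond big_imfset /=; last first.
    by move=> e e' _ _ /(sqfree_inj p_prime p_inj).
  rewrite -big_mkcond /= big_enum_cond /=.
  pose z : {ffun 'I_k -> bool} := [ffun=> false].
  have Pz : sqfree p z = 1%N by apply/eqP; rewrite sqfree_eq1.
  have sz : (\sum_(i < k) z i)%N = 0%N.
    by rewrite big1 // => i _; rewrite ffunE.
  (* The empty subset is the term n = 1 and supplies the leading 2^k B. *)
  rewrite [leRHS](bigD1 z) /= ?Pz // sz.
  rewrite expr0 !invr1 mulr1 lerD2l le_eqVlt; apply/orP; left; apply/eqP.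
  apply: eq_big => [d|d _].
    rewrite -(sqfree_eq1 p_prime p_inj) andbC ltn_neqAle sqfree_gt0 // andbT.
    by rewrite [1%N == _]eq_sym.
  by rewrite -(omega_sqfree p_prime p_inj).
- move=> /fsubsetP FB; apply: le_trans lower.
  rewrite ler_wpM2l ?mulr_ge0 ?exprn_ge0 //.
  (* As F lies in [1, B], the condition P d <= B holds for every [d], so the sum is the full
     product. *)
  rewrite prod_half_inv le_eqVlt; apply/orP; left; apply/eqP.
  apply: eq_bigl => d; apply/esym.
  have /FB : sqfree p d \in F by apply/imfsetP; exists d.
  by rewrite !inE mem_iota add1n ltnS => /andP[].
Qed.
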